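(* For a positive integer $t \geq 3$, let $G$ be a connected $K_{1,t}$-free graph and let $l$ be an integer with $l \neq t-2$. If $$\sigma^{4}_{l+1}(G)\geq |G|-\left\lfloor \frac{l(t-1)}{t-2}\right\rfloor-1,$$ then $G$ has a spanning tree with $l$-ended stem, i.e. a spanning tree $T$ of $G$ such that $Stem(T)$ has at most $l$ leaves.
   Context: All graphs are finite and simple. For a graph $G$ with vertex set $V(G)$, $|G|$ denotes the number of vertices of $G$, $\deg_G(v)$ the degree of $v$ in $G$, and $d_G(u,v)$ the distance between $u$ and $v$ in $G$. A graph is $K_{1,t}$-free if it contains no $K_{1,t}$ (star with $t$ leaves) as an induced subgraph. For an integer $m \geq 2$, let $$\alpha^{m}(G)=\max\{|S| : S\subseteq V(G),\ d_G(x,y)\geq m \text{ for all distinct } x,y\in S\}.$$ For integers $m \geq 2$ and $p\geq 2$, let $$\sigma^{m}_{p}(G)=\min\left\{\sum_{a\in S}\deg_G(a) : S\subseteq V(G),\ |S|=p,\ d_G(x,y)\geq m \text{ for all distinct } x,y\in S\right\},$$ with the convention $\sigma^m_p(G)=+\infty$ if $\alpha^m(G)<p$. For a tree $T$, a leaf is a vertex of degree one in $T$, and $Leaf(T)$ is the set of leaves of $T$. The stem of $T$ is the subtree $Stem(T)=T-Leaf(T)$ obtained by deleting all leaves of $T$. The leaves of $Stem(T)$ are the vertices of degree one in the tree $Stem(T)$. The stem is called $l$-ended if it has at most $l$ leaves. $\lfloor r\rfloor$ denotes the largest integer not exceeding the real number $r$.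
   Formalization: The theorem is stated for l ≥ 2: for l ≤ 0 the quantity σ^4_{l+1} is undefined, and for l = 1 (t ≥ 4) the claim is false, since P_4 has σ^4_2 = +∞ but its only spanning tree has a stem with two leaves. *)

(* Defs.v *)
From mathcomp Require Import all_boot all_order all_algebra.
From mathcomp Require Export constructive_ereal.

Set Implicit Arguments.
Unset Strict Implicit.
Unset Printing Implicit Defensive.

Import Order.TTheory GRing.Theory Num.Theory.

(* A graph on the finite vertex type V is given by its adjacency relation.    *)
Definition simple_graph (V : finType) (e : rel V) : Prop :=
  symmetric e /\ irreflexive e.

(* A connected graph has at least one vertex. *)
Definition connected_graph (V : finType) (e : rel V) : Prop :=
  0 < #|V| /\ forall x y : V, connect e x y.

Definition deg (V : finType) (e : rel V) (x : V) : nat := #|[set y | e x y]|.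

(* The minimum length of a walk from x to y. Lengths up to #|V| - 1 suffice,  *)
(* and the value is +oo when y is not reachable from x.                       *)
Definition dist (V : finType) (e : rel V) (x y : V) : \bar int :=
  \big[Order.min/+oo%E]_(k < #|V|
      | [exists p : k.-tuple V, path e x p && (last x p == y)]) (k%:Z)%:E.

Definition spread (V : finType) (e : rel V) (m : nat) (S : {set V}) : bool :=
  [forall x in S, forall y in S, (x != y) ==> ((m%:Z)%:E <= dist e x y)%E].

(* The minimum over the empty family is +oo, so sigma e m p = +oo exactly     *)
(* when no p vertices are pairwise at distance at least m.                    *)
Definition sigma (V : finType) (e : rel V) (m p : nat) : \bar int :=
  \big[Order.min/+oo%E]_(S : {set V} | (#|S| == p) && spread e m S)
    ((\sum_(a in S) deg e a)%N%:Z)%:E.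

Definition has_induced (W V : finType) (h : rel W) (e : rel V) : Prop :=
  exists phi : W -> V, injective phi /\ {mono phi : x y / h x y >-> e x y}.

(* K_{1,t}, with centre None and leaves Some i. *)
Definition star (t : nat) : rel (option 'I_t) :=
  fun x y => isSome x != isSome y.
Arguments star : clear implicits.

Definition acyclic (V : finType) (e : rel V) : Prop :=
  forall c : seq V, 2 < size c -> ~ ucycle e c.

Definition tree (V : finType) (f : rel V) : Prop :=
  [/\ simple_graph f, connected_graph f & acyclic f].

Definition spanning_tree (V : finType) (e f : rel V) : Prop :=
  subrel f e /\ tree f.

Definition leaves (V : finType) (f : rel V) : {set V} :=
  [set x | deg f x == 1].

(* The subgraph of f induced on the vertices that are not leaves of f.        *)
Definition stem (V : finType) (f : rel V) : rel {x : V | x \notin leaves f} :=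
  fun x y => f (val x) (val y).
Arguments stem [V] f.

(* Main.v *)
(* Spanning trees with few stem leaves come from subtrees T of G that dominate
   G and have few leaves. Let T have the least number k of leaves and, subject
   to that, the fewest vertices, and suppose k > l. By the second choice every
   leaf x has a neighbour y_x outside T with no other neighbour in T. By the
   first choice G has no path between two leaves of T with interior outside T
   (it would close a cycle through a branch vertex, and cutting an edge there
   would save a leaf), so the y_x are pairwise at distance at least 4, and
   sigma bounds |T| by floor(l(t-1)/(t-2)) + 1.
   Root T at an internal vertex and choose it, on the same vertices and with k
   leaves, so that the sum of the levels is maximal. Two siblings a, b with
   parent v are then nonadjacent, since replacing va by ab would push a down.
   As G is K_{1,t}-free, internal vertices have degree at most t, and the root
   and a deepest internal vertex have degree at most t - 1. The degree sum of T
   gives k <= (t - 2)b for b >= 2 internal vertices, which contradicts the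
   bound on |T| = k + b; for b = 1 one has k <= t - 1, and l <> t - 2 is what
   excludes this case. *)

Require Import Defs.
From mathcomp Require Import all_boot all_order all_algebra.
From mathcomp Require Import constructive_ereal.
From mathcomp Require Import zify.

(** * Subtrees of a graph encoded as symmetric edge sets *)

Section Subtrees.

Set Implicit Arguments.
Unset Strict Implicit.

Variables (V : finType) (e : rel V).
Hypotheses (e_sym : symmetric e) (e_irr : irreflexive e).

Implicit Types (S A : {set V}) (E : {set V * V}).

Definition adj E : rel V := fun x y => (x, y) \in E.

(* Edge sets contain both orientations of each edge. *)
Definition edge (x y : V) : {set V * V} := [set p in [:: (x, y); (y, x)]].

(** Symmetry puts the second endpoint of an edge in [S] as well. The pair of empty sets is allowed
    here; the cardinality bound of [subtree] rules it out. *)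
Definition connects S E : bool :=
  [forall x, forall y, adj E x y ==> [&& adj E y x, e x y & x \in S]]
  && [forall x in S, forall y in S, connect (adj E) x y].

(* The cardinality condition reads |E(T)| <= |V(T)| - 1 in unoriented edges. *)
Definition subtree S E : bool := connects S E && (#|E|.+2 <= 2 * #|S|).

Lemma adjU E1 E2 x y : adj (E1 :|: E2) x y = adj E1 x y || adj E2 x y.
Proof. by rewrite /adj inE. Qed.

Lemma adjD E1 E2 x y : adj (E1 :\: E2) x y = adj E1 x y && ~~ adj E2 x y.
Proof. by rewrite /adj inE andbC. Qed.

Lemma adj_edge a b x y :
  adj (edge a b) x y = ((x == a) && (y == b)) || ((x == b) && (y == a)).
Proof. by rewrite /adj !inE !xpair_eqE. Qed.

Lemma card_edge a b : #|edge a b| <= 2.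
Proof. by rewrite cardsE; apply: card_size. Qed.

Lemma connectsP S E :
  reflect [/\ forall x y, adj E x y -> adj E y x,
              forall x y, adj E x y -> e x y,
              forall x y, adj E x y -> x \in S
            & forall x y, x \in S -> y \in S -> connect (adj E) x y]
          (connects S E).
Proof.
apply: (iffP andP) => [[/forallP H1 /'forall_in_forall_inP H2]|[H1 H2 H3 H4]].
  have H x y : adj E x y -> [&& adj E y x, e x y & x \in S].
    by move/forallP: (H1 x) => /(_ y) /implyP.
  split=> [x y /H/and3P[]|x y /H/and3P[]|x y /H/and3P[]|] //.
  by move=> x y xS yS; apply: H2.
split; last by apply/'forall_in_forall_inP => x xS y yS; apply: H4.
apply/forallP=> x; apply/forallP=> y; apply/implyP=> Exy.
by rewrite (H1 _ _ Exy) (H2 _ _ Exy) (H3 _ _ Exy).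
Qed.

Lemma adj_neq S E x y : connects S E -> adj E x y -> x != y.
Proof.
by case/connectsP=> _ He _ _ /He; apply: contraTneq => ->; rewrite e_irr.
Qed.

(** An edge may be sent to a walk of any length, even zero, so [phi] may contract edges; this serves
    to fold a leaf onto its neighbour. *)
Lemma connect_hom (r1 r2 : rel V) (phi : V -> V) x y :
  (forall a b, r1 a b -> connect r2 (phi a) (phi b)) ->
  connect r1 x y -> connect r2 (phi x) (phi y).
Proof.
move=> H /connectP[p]; elim: p x => [|z p IH] x /=.
  by move=> _ ->.
by case/andP=> /H xz /IH{}IH /IH; apply: connect_trans.
Qed.

Lemma connect_exit (r : rel V) (A : {set V}) x y :
  connect r x y -> x \in A -> y \notin A ->
  exists a b, [/\ a \in A, b \notin A & r a b].
Proof.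
case/connectP=> p; elim: p x => [|z p IH] x /=.
  by move=> _ -> ->.
case/andP=> xz pz yl xA yA; case zA: (z \in A); first exact: IH pz yl zA yA.
by exists x, z; rewrite zA.
Qed.

(* A connected graph is explored one vertex at a time, and every new vertex
   brings an edge, counted in both directions. *)
Lemma connects_card S E : connects S E -> 2 * #|S| <= #|E|.+2.
Proof.
move=> SE; have [E_sym _ ES E_conn] := connectsP _ _ SE.
case: (set_0Vmem S) => [->|[r rS]]; first by rewrite cards0.
have grow n : n < #|S| -> exists A : {set V},
    [/\ r \in A, A \subset S, #|A| = n.+1
      & 2 * n <= #|[set u in E | (u.1 \in A) && (u.2 \in A)]|].
  elim: n => [_|n IH nS].
    by exists [set r]; rewrite set11 sub1set rS cards1.
  have [A [rA AS cA hA]] := IH (ltnW nS).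
  have /properP[_ [z zS zA]] : A \proper S by rewrite properEcard AS cA.
  have [a [b [aA bA ab]]] := connect_exit (E_conn _ _ rS zS) rA zA.
  have bS : b \in S by apply: ES (E_sym _ _ ab).
  exists (b |: A); split.
  - by rewrite inE rA orbT.
  - by rewrite subUset sub1set bS.
  - by rewrite cardsU1 bA cA.
  set B := [set u in E | _]; set C := [set u in E | _] in hA.
  have Cab : [disjoint C & edge a b].
    rewrite disjoint_sym; apply/pred0P=> [[x y]] /=; apply/negP.
    case/andP=> + ; rewrite !inE !xpair_eqE /=.
    by case/orP=> /andP[/eqP-> /eqP->]; rewrite (negPf bA) ?andbF.
  have sub : C :|: edge a b \subset B.
    apply/subsetP=> [[x y]]; rewrite !inE !xpair_eqE /=.
    case/orP=> [/and3P[-> -> ->]|]; first by rewrite !orbT.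
    case/orP=> /andP[/eqP-> /eqP->]; rewrite aA eqxx !orbT /= andbT //.
    exact: E_sym.
  have ce : #|edge a b| = 2.
    rewrite cardsE; apply: (card_uniqP _ : #|_| = size [:: (a, b); (b, a)]).
    by rewrite /= inE xpair_eqE negb_and andbT (adj_neq SE ab).
  move: (subset_leq_card sub); rewrite cardsU disjoint_setI0 // cards0 ce.
  by move: hA; move: #|C| #|B| => p q; clear; lia.
have S_gt0 : 0 < #|S| by apply/card_gt0P; exists r.
have [|A [_ _ _ hA]] := grow #|S|.-1; first by rewrite prednK.
have : #|[set u in E | (u.1 \in A) && (u.2 \in A)]| <= #|E|.
  by apply: subset_leq_card; apply/subsetP=> u; rewrite inE => /andP[].
move: hA S_gt0; move: #|[set u in E | _]| #|S| #|E| => p q s.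
by clear; lia.
Qed.

Lemma subtree_card S E : subtree S E -> #|E|.+2 = 2 * #|S|.
Proof. by case/andP=> /connects_card; move: #|S| #|E| => p q; clear; lia. Qed.

Lemma subtree_connects S E : subtree S E -> connects S E.
Proof. by case/andP. Qed.

(** The handshake identity; no factor 2 appears because [E] holds both orientations. *)
Lemma sum_deg S E : connects S E -> \sum_(x in S) deg (adj E) x = #|E|.
Proof.
move=> SE; have [E_sym _ ES E_conn] := connectsP _ _ SE.
rewrite -sum1_card (eq_bigl (fun u => ((u.1 \in S) && adj E u.1 u.2))); last first.
  case=> x y /=; rewrite -/(adj E x y).
  by case xy: (adj E x y); rewrite ?andbF // (ES _ _ xy).
rewrite -(pair_big_dep (mem S) (adj E) (fun _ _ => 1)) /=.
by apply: eq_bigr => x _; rewrite sum1_card /deg cardsE.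
Qed.

Lemma deg_gt0 S E x : connects S E -> 1 < #|S| -> x \in S -> 0 < deg (adj E) x.
Proof.
move=> SE; have [E_sym _ ES E_conn] := connectsP _ _ SE.
move=> /card_gt1P[y [z [yS zS yz]]] xS.
have [w wS wx] : exists2 w, w \in S & w != x.
  have [yx|] := eqVneq y x; last by exists y.
  by exists z => //; rewrite -yx eq_sym.
have [||a [b [/set1P-> _ ab]]] := @connect_exit _ [set x] _ _ (E_conn _ _ xS wS).
- by rewrite set11.
- by rewrite inE.
by apply/card_gt0P; exists b; rewrite inE.
Qed.

Lemma deg_notin S E x : connects S E -> x \notin S -> deg (adj E) x = 0.
Proof.
case/connectsP=> _ _ ES _ xS; apply/eqP; rewrite cards_eq0.
by apply: contraNT xS => /set0Pn[y]; rewrite inE => /ES.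
Qed.

Lemma leaf_in S E x : connects S E -> x \in leaves (adj E) -> x \in S.
Proof.
move=> SE; rewrite inE; apply: contraLR => /(deg_notin SE) ->.
by [].
Qed.

Lemma leafP E x :
  x \in leaves (adj E) -> exists2 w, adj E x w & forall y, adj E x y -> y = w.
Proof.
rewrite inE => /cards1P[w Nw]; exists w.
  by have := set11 w; rewrite -Nw inE.
by move=> y xy; apply/set1P; rewrite -Nw inE.
Qed.

Lemma deg_ge2 E x a b : adj E x a -> adj E x b -> a != b -> 1 < deg (adj E) x.
Proof. by move=> xa xb ab; apply/card_gt1P; exists a, b; rewrite !inE. Qed.

Lemma subtree1 r : subtree [set r] set0.
Proof.
rewrite /subtree cards0 cards1 andbT; apply/connectsP.
by split=> [x y|x y|x y|x y]; rewrite /adj !inE // => /eqP-> /eqP->.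
Qed.

Lemma subtree_pendant S E x u : subtree S E -> x \in S -> u \notin S -> e x u ->
  subtree (u |: S) (E :|: edge x u).
Proof.
case/andP=> SE cE xS uS xu; have [E_sym Ee ES E_conn] := connectsP _ _ SE.
apply/andP; split; last first.
  rewrite cardsU1 uS /=; have := card_edge x u.
  have := (leq_card_setU E (edge x u)).1; move: cE.
  by move: #|E| #|edge x u| #|E :|: _| => p q r; clear; lia.
have sub : subrel (adj E) (adj (E :|: edge x u)) by move=> a b; rewrite adjU => ->.
have new_sym a b : adj (E :|: edge x u) a b -> adj (E :|: edge x u) b a.
  rewrite !adjU !adj_edge => /orP[/E_sym ->//|].
  by case/orP=> /andP[-> ->]; rewrite !orbT.
apply/connectsP; split=> //.
- move=> a b; rewrite adjU adj_edge => /orP[/Ee //|].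
  by case/orP=> /andP[/eqP-> /eqP->] //; rewrite e_sym.
- move=> a b; rewrite adjU adj_edge => /orP[/ES aS|]; first by rewrite inE aS orbT.
  by case/orP=> /andP[/eqP-> _]; rewrite !inE ?eqxx ?xS ?orbT.
have c_sym : connect_sym (adj (E :|: edge x u)).
  by apply: sym_connect_sym => a b; apply/idP/idP; apply: new_sym.
have tox a : a \in u |: S -> connect (adj (E :|: edge x u)) a x.
  rewrite !inE => /orP[/eqP->|aS].
    by apply: connect1; rewrite adjU adj_edge !eqxx !orbT.
  by apply: connect_sub (E_conn _ _ aS xS) => p q /sub; apply: connect1.
move=> a b /tox ax /tox; rewrite c_sym; exact: connect_trans.
Qed.

(** The vertex [x] gains a second neighbour and [u] takes over as a leaf, so the number of leaves is
    kept. *)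
Lemma leaves_pendant S E x u : subtree S E -> x \in leaves (adj E) ->
  u \notin S -> e x u ->
  leaves (adj (E :|: edge x u)) = u |: (leaves (adj E) :\ x).
Proof.
move=> /subtree_connects SE xl uS xu; have xS := leaf_in SE xl.
have [E_sym Ee ES E_conn] := connectsP _ _ SE.
have [w xw xuniq] := leafP xl.
have ux : u != x by apply: contraNneq uS => ->.
apply/setP=> y; rewrite !inE.
have [->|yu] := eqVneq y u.
  rewrite /=; apply/cards1P; exists x; apply/setP=> z.
  rewrite !inE adjU adj_edge eqxx (negPf ux) /=.
  by case uz: (adj E u z) => //=; rewrite (ES _ _ uz) in uS.
have [->|yx] := eqVneq y x.
  apply/negbTE; rewrite neq_ltn; apply/orP; right.
  apply: (@deg_ge2 _ _ w u); rewrite ?adjU ?xw // ?adj_edge ?eqxx ?orbT //.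
  by apply: contraNneq uS => <-; apply: ES (E_sym _ _ xw).
congr (_ == _); apply: eq_card => z.
by rewrite !inE adjU adj_edge (negPf yu) (negPf yx) orbF.
Qed.

(** * Exchanging edges *)

Lemma connects_add S E x z : connects S E -> x \in S -> z \in S -> e x z ->
  connects S (E :|: edge x z).
Proof.
case/connectsP=> E_sym Ee ES E_conn xS zS xz; apply/connectsP; split.
- move=> a b; rewrite !adjU !adj_edge => /orP[/E_sym ->//|].
  by case/orP=> /andP[-> ->]; rewrite !orbT.
- move=> a b; rewrite adjU adj_edge => /orP[/Ee //|].
  by case/orP=> /andP[/eqP-> /eqP->] //; rewrite e_sym.
- move=> a b; rewrite adjU adj_edge => /orP[/ES //|].
  by case/orP=> /andP[/eqP-> _].
- move=> a b aS bS; apply: connect_sub (E_conn _ _ aS bS) => p q pq.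
  by apply: connect1; rewrite adjU pq.
Qed.

(** Each use of the edge [v c] in a walk is replaced by the detour from [v] to [c]. *)
Lemma connects_del S E v c : connects S E ->
  connect (adj (E :\: edge v c)) v c -> connects S (E :\: edge v c).
Proof.
case/connectsP=> E_sym Ee ES E_conn vc.
have new_sym a b : adj (E :\: edge v c) a b -> adj (E :\: edge v c) b a.
  rewrite !adjD !adj_edge => /andP[/E_sym ->] /=.
  by rewrite orbC [(b == v) && _]andbC [(b == c) && _]andbC.
have c_sym : connect_sym (adj (E :\: edge v c)).
  by apply: sym_connect_sym => a b; apply/idP/idP; apply: new_sym.
apply/connectsP; split=> //.
- by move=> a b; rewrite adjD => /andP[/Ee].
- by move=> a b; rewrite adjD => /andP[/ES].
- move=> a b aS bS; apply: connect_sub (E_conn _ _ aS bS) => p q pq.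
  case vcE: (adj (edge v c) p q); last by apply: connect1; rewrite adjD pq vcE.
  move: vcE; rewrite adj_edge => /orP[]/andP[/eqP-> /eqP->] //.
  by rewrite c_sym.
Qed.

Lemma card_del_edge S E v c : connects S E -> adj E v c ->
  #|E :\: edge v c|.+2 = #|E|.
Proof.
move=> SE vc; have [E_sym _ _ _] := connectsP _ _ SE.
have sub : edge v c \subset E.
  apply/subsetP=> u; rewrite !inE => /orP[]/eqP->; first exact: vc.
  exact: E_sym.
have ce : #|edge v c| = 2.
  rewrite cardsE; apply: (card_uniqP _ : #|_| = size [:: (v, c); (c, v)]).
  by rewrite /= inE xpair_eqE negb_and andbT (adj_neq SE vc).
move: (subset_leq_card sub); rewrite cardsD (setIidPr sub) ce.
by move: #|E| => n; clear; lia.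
Qed.

(** Otherwise deleting the edge would leave [S] connected by fewer edges than [connects_card]
    permits. Acyclicity is used in this form. *)
Lemma bridge S E v c : subtree S E -> adj E v c ->
  ~~ connect (adj (E :\: edge v c)) v c.
Proof.
move=> SE vc; apply/negP=> /(connects_del (subtree_connects SE)).
move/connects_card; have := card_del_edge (subtree_connects SE) vc.
by case/andP: SE => _; move: #|E| #|_ :\: _| => n m; clear; lia.
Qed.

Definition exchange E x z v c := (E :|: edge x z) :\: edge v c.

Lemma adj_exchange E x z v c a b : adj (exchange E x z v c) a b =
  (adj E a b || adj (edge x z) a b) && ~~ adj (edge v c) a b.
Proof. by rewrite adjD adjU. Qed.

Lemma subtree_exchange S E x z v c : subtree S E -> x \in S -> z \in S ->
  e x z -> adj E v c -> connect (adj (exchange E x z v c)) v c ->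
  subtree S (exchange E x z v c).
Proof.
case/andP=> SE cE xS zS xz vc vc'; have SE' := connects_add SE xS zS xz.
rewrite /subtree (connects_del SE' vc') /=.
have vc1 : adj (E :|: edge x z) v c by rewrite adjU vc.
have := card_del_edge SE' vc1; move: cE; have := card_edge x z.
have := (leq_card_setU E (edge x z)).1; rewrite /exchange.
by move: #|E| #|edge x z| #|E :|: _| #|_ :\: _| => p q r s; clear; lia.
Qed.

Lemma deg_sub E E' x (A : {set V}) :
  (forall y, adj E x y -> y \notin A -> adj E' x y) ->
  deg (adj E) x <= deg (adj E') x + #|A|.
Proof.
move=> H; rewrite /deg; apply: leq_trans (leq_card_setU _ _).1.
apply: subset_leq_card; apply/subsetP=> y; rewrite !inE => xy.
by case yA: (y \in A); rewrite ?orbT // orbF H // yA.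
Qed.

(** Only [v] and [c] can lose a neighbour, and [v] keeps at least two, so [c] is the only possible
    new leaf. *)
Lemma leaves_exchange S E x z v c y : connects S E -> adj E v c ->
  2 < deg (adj E) v ->
  y \in leaves (adj (exchange E x z v c)) -> y \in S ->
  (y == c) || (y \in leaves (adj E)).
Proof.
move=> SE vc v3 yl yS; have [E_sym _ ES _] := connectsP _ _ SE.
have vc_neq := adj_neq SE vc.
have [//|yc] := eqVneq y c; have [yv|yv] := eqVneq y v.
  have := @deg_sub E (exchange E x z v c) v [set c].
  rewrite cards1; move: yl; rewrite yv inE => /eqP-> H.
  suff /H : forall w, adj E v w -> w \notin [set c] -> adj (exchange E x z v c) v w.
    by rewrite leqNgt v3.
  move=> w vw; rewrite inE adj_exchange (adj_edge v _) vw eqxx (negPf vc_neq).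
  by rewrite /= orbF => ->.
have := @deg_sub E (exchange E x z v c) y set0.
move: yl; rewrite !inE cards0 => /eqP->.
have S2 : 1 < #|S|.
  by apply/card_gt1P; exists v, c; split=> //; [apply: ES vc | apply: ES (E_sym _ _ vc)].
have := deg_gt0 SE S2 yS => d0 H; rewrite eqn_leq d0 andbT.
by apply: H => w yw _; rewrite adj_exchange (adj_edge v _) yw (negPf yv) (negPf yc).
Qed.

Lemma not_leaf_exchange S E x z v c : connects S E -> x \in S -> 1 < #|S| ->
  ~~ adj E x z -> x != v -> x != c ->
  x \notin leaves (adj (exchange E x z v c)).
Proof.
move=> SE xS S2 xz xv xc; have /card_gt0P[w] := deg_gt0 SE S2 xS.
rewrite inE => xw.
have : 1 < deg (adj (exchange E x z v c)) x.
  apply: (@deg_ge2 _ _ w z).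
  - by rewrite adj_exchange (adj_edge v c) xw (negPf xv) (negPf xc).
  - by rewrite adj_exchange !adj_edge !eqxx (negPf xv) (negPf xc) orbT.
  - by apply: contraNneq xz => <-.
by rewrite inE neq_ltn orbC => ->.
Qed.

(** Trading the edge [v a] for [b a] keeps the degree of [a], gives [b] a second neighbour besides
    [v], and takes from [v] one of at least three neighbours. *)
Lemma subtree_rotate S E v a b : subtree S E -> adj E v a -> adj E v b ->
  a != b -> e a b -> 2 < deg (adj E) v ->
  subtree S (exchange E b a v a)
  /\ leaves (adj (exchange E b a v a)) \subset leaves (adj E) :\ b.
Proof.
move=> SE va vb ab eab v3; have SE1 := subtree_connects SE.
have [E_sym _ ES _] := connectsP _ _ SE1.
have nva := adj_neq SE1 va; have nvb := adj_neq SE1 vb.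
have aS : a \in S by apply: ES (E_sym _ _ va).
have bS : b \in S by apply: ES (E_sym _ _ vb).
have vS : v \in S by apply: ES va.
have S2 : 1 < #|S| by apply/card_gt1P; exists v, a.
(* A triangle on [v], [a], [b] would bypass the bridge [v a]. *)
have nba : ~~ adj E b a.
  apply: contra (bridge SE va) => ba; apply: (@connect_trans _ _ b).
    apply: connect1; rewrite adjD adj_edge vb eqxx (negPf nva) /= orbF eq_sym //.
  apply: connect1; rewrite adjD adj_edge ba eqxx eq_sym (negPf nvb) /=.
  by rewrite eq_sym (negPf ab).
have vb' : adj (exchange E b a v a) v b.
  by rewrite adj_exchange (adj_edge v _) vb eqxx (negPf nva) /= orbF eq_sym.
have ba' : adj (exchange E b a v a) b a.
  rewrite adj_exchange !adj_edge !eqxx /= orbT /=.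
  by rewrite eq_sym (negPf nvb) /= eq_sym (negPf ab).
have SE' : subtree S (exchange E b a v a).
  apply: subtree_exchange => //; first by rewrite e_sym.
  exact: connect_trans (connect1 vb') (connect1 ba').
split=> //; apply/subsetP=> y yl.
have yS := leaf_in (subtree_connects SE') yl.
have yb : y != b.
  apply: contraTneq (yl) => ->; apply: (not_leaf_exchange SE1) => //.
    by rewrite eq_sym nvb.
  by rewrite eq_sym ab.
have /orP[/eqP ya|yl'] := leaves_exchange SE1 va v3 yl yS; last first.
  by rewrite in_setD1 yb yl'.
rewrite in_setD1 yb inE /=; move: yl; rewrite ya inE => /eqP d1.
rewrite eqn_leq (deg_gt0 SE1) // andbT.
have /cards1P[w Nw] := introT eqP d1.
(* As a leaf of the new tree, [a] has [b] as its only neighbour, so before the exchange its only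
   neighbour was [v]. *)
have wb : w = b.
  have : b \in [set y | adj (exchange E b a v a) a y].
    by have [sym' _ _ _] := connectsP _ _ (subtree_connects SE'); rewrite inE sym'.
  by rewrite Nw inE => /eqP.
suff /subset_leq_card : [set y | adj E a y] \subset [set v] by rewrite cards1.
apply/subsetP=> u; rewrite !inE => au; apply: contraT => uv.
have : u \in [set y | adj (exchange E b a v a) a y].
  by rewrite inE adj_exchange au (adj_edge v a) eqxx eq_sym (negPf nva) /= uv.
by rewrite Nw wb inE => /eqP ub; rewrite ub in au; rewrite (E_sym _ _ au) in nba.
Qed.

(** The edge [x z] closes a cycle, from which the way to a third leaf branches off at some vertex
    [v]. After a cycle edge [v c] is deleted, the only possible leaves are [c] and the old ones
    other than [x] and [z]. *)
Lemma adjacent_leaves S E x z : subtree S E -> 2 < #|leaves (adj E)| ->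
  x \in leaves (adj E) -> z \in leaves (adj E) -> x != z -> e x z ->
  exists2 E', subtree S E' & #|leaves (adj E')| < #|leaves (adj E)|.
Proof.
move=> SE k3 xl zl xz exz; have SE1 := subtree_connects SE.
have [E_sym _ ES E_conn] := connectsP _ _ SE1.
have xS := leaf_in SE1 xl; have zS := leaf_in SE1 zl.
have S2 : 1 < #|S| by apply/card_gt1P; exists x, z.
have [w [wl wx wz]] : exists w, [/\ w \in leaves (adj E), w != x & w != z].
  have : 0 < #|leaves (adj E) :\ x :\ z|.
    have := cardsD1 x (leaves (adj E)); have := cardsD1 z (leaves (adj E) :\ x).
    rewrite xl => h1 h2; move: k3; rewrite h2 h1.
    move: #|_ :\ z| => n; case: (z \in _); clear; lia.
  by case/card_gt0P=> w; rewrite !in_setD1 => /and3P[]; exists w.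
have wS := leaf_in SE1 wl.
(* Two leaves joined by a tree edge would form a component without [w]. *)
have nxz : ~~ adj E x z.
  apply/negP=> axz.
  have [|| a [b []]] := connect_exit (E_conn _ _ xS wS) (A := [set x; z]).
  - by rewrite !inE eqxx.
  - by rewrite !inE negb_or wx.
  rewrite !inE negb_or => /orP[]/eqP-> /andP[bx bz] ab.
    by have [u _ Hu] := leafP xl; rewrite (Hu _ ab) (Hu _ axz) eqxx in bz.
  by have [u _ Hu] := leafP zl; rewrite (Hu _ ab) (Hu _ (E_sym _ _ axz)) eqxx in bx.
have /connectP[q0 q0p q0l] := E_conn _ _ zS xS.
have [p [pz up pl]] : exists p, [/\ path (adj E) z p, uniq (z :: p) & last z p = x].
  by rewrite q0l; case/shortenP: q0p => p pz up _; exists p.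
(* An inner vertex of the path has two neighbours on it, so the leaf [w] is off the path. *)
have wp : w \notin z :: p.
  rewrite inE (negPf wz) /=; apply/negP=> wp.
  case/splitPr: wp pz up pl => p1 [|c p3].
    by rewrite last_cat /= => _ _ wx'; rewrite wx' eqxx in wx.
  rewrite cat_path -cat_cons cat_uniq => /andP[_ /= /and3P[lw wc _]].
  case/and3P=> _ H _ _.
  have [u _ Hu] := leafP wl.
  have lc : last z p1 = c by rewrite (Hu _ wc) (Hu _ (E_sym _ _ lw)).
  by move: H; rewrite -lc mem_last orbT.
have [|| v [b [vp bp vb]]] := connect_exit (E_conn _ _ zS wS) (A := [set u in z :: p]).
- by rewrite !inE eqxx.
- by rewrite inE.
rewrite inE in vp; rewrite inE in bp.
have {vp} vp : v \in p.
  move: vp; rewrite inE => /orP[/eqP vz|//].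
  case: p pz pl bp {up wp} => [|h p] /=; first by move=> _ zx; rewrite zx eqxx in xz.
  case/andP=> zh _ _; rewrite !inE; have [u _ Hu] := leafP zl.
  by rewrite -vz in Hu zh *; rewrite (Hu _ vb) (Hu _ zh) eqxx orbT.
(* [c] is the successor of [v] towards [x]; it exists because the leaf [x] has no neighbour off the
   path. *)
case/splitPr: vp pz up pl wp bp => p1 [|c p3].
  rewrite cat_path last_cat /= andbT => /andP[_ lv] _ vx _ bp.
  have [u _ Hu] := leafP xl; rewrite vx in vb lv.
  move: bp; rewrite (Hu _ vb) -(Hu _ (E_sym _ _ lv)).
  by rewrite -cat_cons mem_cat mem_last.
rewrite cat_path last_cat /= => /and4P[p1p lv vc p3p] up pl _ bp.
have Up : uniq (z :: p1 ++ v :: c :: p3) := up.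
have vp1 : v \notin z :: p1.
  move: Up; rewrite -cat_cons cat_uniq => /and3P[_ /hasPn/(_ v) + _].
  by apply; rewrite mem_head.
have cp1 : c \notin z :: p1.
  move: Up; rewrite -cat_cons cat_uniq => /and3P[_ /hasPn/(_ c) + _].
  by apply; rewrite in_cons mem_head orbT.
have vcp3 : v \notin c :: p3.
  move: Up; rewrite -cat_cons cat_uniq => /and3P[_ _].
  by rewrite cons_uniq => /andP[].
have v3 : 2 < deg (adj E) v.
  apply/card_gt2P; exists (last z p1), c, b; rewrite !inE vc vb (E_sym _ _ lv).
  split=> //; split.
  - by apply: contraNneq cp1 => <-; apply: mem_last.
  - by apply: contraNneq bp => <-; rewrite -cat_cons mem_cat !inE eqxx !orbT.
  - by apply: contraNneq bp => ->; rewrite -cat_cons mem_cat mem_last.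
have xin : x \in c :: p3 by rewrite -pl mem_last.
have xv : x != v by apply: contraNneq vcp3 => <-.
have zv : z != v by apply: contraNneq vp1 => <-; rewrite mem_head.
have zc : z != c by apply: contraNneq cp1 => <-; rewrite mem_head.
pose E' := exchange E x z v c.
(* The deleted edge is bypassed along the rest of the cycle: from [c] to [x], over the new edge to
   [z], and on to [v]. *)
have SE' : subtree S E'.
  apply: subtree_exchange => //.
  have c_sym : connect_sym (adj E').
    apply: sym_connect_sym => a1 a2; rewrite !adj_exchange !adj_edge.
    rewrite (_ : adj E a1 a2 = adj E a2 a1); last by apply/idP/idP; apply: E_sym.
    rewrite ![(a2 == _) && _]andbC; congr (_ && ~~ _); last by rewrite orbC.
    by congr (_ || _); rewrite orbC.
  have zv' : connect (adj E') z v.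
    apply/connectP; exists (rcons p1 v); last by rewrite last_rcons.
    apply: (@sub_in_path _ (predC1 c) (adj E)).
    - move=> a1 a2; rewrite !inE => a1c a2c a12.
      by rewrite adj_exchange (adj_edge v _) a12 (negPf a1c) (negPf a2c) andbF.
    - apply/allP=> u; rewrite -rcons_cons mem_rcons in_cons /=.
      case/orP=> [/eqP->|up1]; first by apply: contraNneq vcp3 => ->; rewrite mem_head.
      by apply: contraNneq cp1 => <-.
    - by rewrite rcons_path p1p.
  have cx : connect (adj E') c x.
    apply/connectP; exists p3 => //.
    apply: (@sub_in_path _ (predC1 v) (adj E)) => //.
    - move=> a1 a2; rewrite !inE => a1c a2c a12.
      by rewrite adj_exchange (adj_edge v _) a12 (negPf a1c) (negPf a2c) andbF.
    - by apply/allP=> u up3; apply: contraNneq vcp3 => <-.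
  have zx' : connect (adj E') x z.
    apply: connect1; rewrite adj_exchange !adj_edge !eqxx orbT /=.
    by rewrite (negPf xv) (negPf zv) andbF.
  rewrite c_sym; apply: connect_trans cx _; exact: connect_trans zx' zv'.
exists E' => //.
have sub : leaves (adj E') \subset c |: (leaves (adj E) :\ x :\ z).
  apply/subsetP=> y yl; have yS := leaf_in (subtree_connects SE') yl.
  rewrite in_setU1 !in_setD1; have [//|yc] := eqVneq y c.
  have /orP[|->] := leaves_exchange SE1 vc v3 yl yS; first by rewrite (negPf yc).
  rewrite andbT /=; apply/andP; split; apply: contraTneq (yl) => yE.
    rewrite yE /E'; have -> : exchange E x z v c = exchange E z x v c.
      rewrite /exchange /edge; congr ((_ :|: _) :\: _).
      by apply/setP=> u; rewrite !inE orbC.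
    apply: (not_leaf_exchange SE1) => //.
    by apply: contra nxz; apply: E_sym.
  by rewrite yE in yc *; apply: (not_leaf_exchange SE1).
apply: leq_ltn_trans (subset_leq_card sub) _; rewrite cardsU1.
have := cardsD1 x (leaves (adj E)); have := cardsD1 z (leaves (adj E) :\ x).
rewrite in_setD1 eq_sym xz zl xl /= => h1 h2; rewrite h2 h1.
by case: (c \in _); rewrite //= ?add0n ?add1n ltnS.
Qed.

(** Among the remaining vertices only the neighbour of [x] changes its degree, so at most this one
    becomes a leaf, in place of [x]. *)
Lemma subtree_remove_leaf S E x : subtree S E -> x \in leaves (adj E) ->
  exists2 E', subtree (S :\ x) E' & #|leaves (adj E')| <= #|leaves (adj E)|.
Proof.
move=> SE xl; have SE1 := subtree_connects SE.
have [E_sym Ee ES E_conn] := connectsP _ _ SE1.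
have [w xw Hw] := leafP xl; have xS := leaf_in SE1 xl.
have nxw := adj_neq SE1 xw.
pose E' := E :\: edge x w.
have offx a b : adj E a b -> a != x -> b != x -> adj E' a b.
  by move=> ab ax bx; rewrite adjD adj_edge ab (negPf ax) (negPf bx) andbF.
have E'x a b : adj E' a b -> (a != x) && (b != x).
  rewrite adjD adj_edge => /andP[ab]; rewrite -negb_or; apply: contra.
  case/orP=> /eqP ex; rewrite ex in ab *; first by rewrite (Hw _ ab) !eqxx.
  by rewrite (Hw _ (E_sym _ _ ab)) !eqxx orbT.
have E'E a b : adj E' a b -> adj E a b by rewrite adjD => /andP[].
have E'_sym a b : adj E' a b -> adj E' b a.
  by move=> ab; have /andP[ax bx] := E'x _ _ ab; apply/offx/ax/bx/E_sym/E'E.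
have SE' : connects (S :\ x) E'.
  apply/connectsP; split=> //.
  - by move=> a b /E'E/Ee.
  - move=> a b ab; rewrite in_setD1; have /andP[-> _] := E'x _ _ ab.
    exact: ES (E'E _ _ ab).
  move=> a b; rewrite !in_setD1 => /andP[ax aS] /andP[bx bS].
  (* Folding [x] onto [w] turns walks of [E] into walks that avoid [x]. *)
  pose phi y := if y == x then w else y.
  have -> : a = phi a by rewrite /phi (negPf ax).
  have -> : b = phi b by rewrite /phi (negPf bx).
  apply: connect_hom (E_conn _ _ aS bS) => p q pq; rewrite /phi.
  have [px|px] := eqVneq p x; have [qx|qx] := eqVneq q x => //.
  - by rewrite px in pq; rewrite (Hw _ pq).
  - by rewrite qx in pq; rewrite (Hw _ (E_sym _ _ pq)).
  - by apply: connect1; apply: offx.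
exists E'.
  rewrite /subtree SE' /=; have := card_del_edge SE1 xw; rewrite -/E'.
  have := subtree_card SE; have := cardsD1 x S; rewrite xS.
  by move: #|E| #|E'| #|S| #|_ :\ _| => p q r s; clear; lia.
have sub : leaves (adj E') \subset w |: (leaves (adj E) :\ x).
  apply/subsetP=> y yl; have := leaf_in SE' yl.
  rewrite in_setU1 !in_setD1 => /andP[yx yS].
  have [//|yw] := eqVneq y w; rewrite yx /=.
  move: yl; rewrite !inE => /eqP<-; apply/eqP/eq_card => z; rewrite !inE.
  apply/idP/idP=> [yz|/E'E//]; apply: offx => //.
  by apply: contraNneq yw => zx; rewrite zx in yz; apply/eqP/Hw/E_sym.
apply: leq_trans (subset_leq_card sub) _; rewrite cardsU1 (cardsD1 x (leaves _)) xl.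
by case: (_ \notin _).
Qed.

(** * Dominating subtrees *)

Definition dominating S : bool :=
  [forall y, (y \in S) || [exists x in S, e x y]].

Lemma dominatingU S u : dominating S -> dominating (u |: S).
Proof.
move/forallP=> H; apply/forallP=> y; case/orP: (H y) => [yS|/'exists_andP[x [xS xy]]].
  by rewrite in_setU1 yS orbT.
by apply/orP; right; apply/'exists_andP; exists x; rewrite in_setU1 xS orbT.
Qed.

(* A leaf can be prolonged out of S without changing the number of leaves. *)
Lemma no_leaf_path S E x p :
  (forall S' E', subtree S' E' -> dominating S' ->
     #|leaves (adj E)| <= #|leaves (adj E')|) ->
  2 < #|leaves (adj E)| -> subtree S E -> dominating S ->
  x \in leaves (adj E) -> last x p \in leaves (adj E) -> p != [::] ->
  path e x p -> uniq (x :: p) ->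
  {in p, forall u, u \in S -> u \in leaves (adj E)} -> False.
Proof.
elim: p S E x => [|u q IH] S E x //= min k3 SE Sd xl lxl _ /andP[xu up].
rewrite inE negb_or => /and3P[/andP[nxu xq] uq Uq] H.
(* If [u] is in [S], it is a leaf adjacent to [x], and an exchange saves a leaf. Otherwise [u]
   replaces [x] as a leaf, and induction handles the rest of the path. *)
have [uS|uS] := boolP (u \in S).
  have [|E' SE' ltE'] := adjacent_leaves SE k3 xl _ nxu xu.
    by apply: H => //; rewrite mem_head.
  by have := min _ _ SE' Sd; rewrite leqNgt ltE'.
have SE1 := subtree_connects SE.
have lE' := leaves_pendant SE xl uS xu.
have cl : #|leaves (adj (E :|: edge x u))| = #|leaves (adj E)|.
  rewrite lE' cardsU1 in_setD1 (cardsD1 x (leaves (adj E))) xl negb_and.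
  by rewrite (contraNN (@leaf_in _ _ u SE1) uS) orbT.
have lq : q != [::] -> last u q \in q.
  by case: (q) => // h q' _; rewrite /= mem_last.
have q0 : q != [::].
  by apply: contraNneq uS => q0; move: lxl; rewrite q0; apply: leaf_in.
apply: (IH (u |: S) (E :|: edge x u) u) => //=; rewrite ?cl ?lE' ?setU11 ?uq //.
- by apply: subtree_pendant => //; apply: leaf_in xl.
- exact: dominatingU.
- by rewrite in_setU1 in_setD1 lxl andbT (memPn xq) ?orbT // lq.
move=> v vq; rewrite !in_setU1 in_setD1 => /orP[->//|vS].
by rewrite (memPn xq) // H ?orbT // in_cons vq orbT.
Qed.

(** Dropping [x] yields a smaller subtree with no more leaves, which by minimality fails to
    dominate; a vertex it misses is dominated by [x] alone. *)
Lemma private_neighbour S E x :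
  (forall S' E', subtree S' E' -> dominating S' ->
     #|leaves (adj E')| <= #|leaves (adj E)| -> #|S| <= #|S'|) ->
  subtree S E -> dominating S -> x \in leaves (adj E) ->
  exists y, [/\ y \notin S, e x y & forall z, z \in S -> e z y -> z = x].
Proof.
move=> min SE Sd xl; have SE1 := subtree_connects SE.
have [E_sym Ee ES E_conn] := connectsP _ _ SE1.
have xS := leaf_in SE1 xl.
have [E' SE' lE'] := subtree_remove_leaf SE xl.
have nd : ~~ dominating (S :\ x).
  apply/negP=> Sxd; have := min _ _ SE' Sxd lE'.
  by rewrite (cardsD1 x S) xS add1n ltnn.
case/forallPn: nd => y; rewrite negb_or negb_exists => /andP[ySx /forallP Hy].
have {}Hy z : z \in S -> e z y -> z = x.
  by move=> zS zy; apply: contraTeq zy => zx; have := Hy z; rewrite in_setD1 zx zS.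
(* The missed vertex is not [x] itself, since the tree neighbour of [x] remains and dominates it. *)
have yS : y \notin S.
  apply: contra ySx => yS; rewrite in_setD1 yS andbT.
  have [w xw _] := leafP xl; apply: contraTneq xw => yx.
  apply/negP=> /E_sym wx.
  have := Hy _ (ES _ _ wx); rewrite yx => /(_ (Ee _ _ wx)) wE.
  by have := adj_neq SE1 wx; rewrite wE eqxx.
exists y; split=> //.
move/forallP: Sd => /(_ y); rewrite (negPf yS) /= => /'exists_andP[z [zS zy]].
by rewrite -(Hy _ zS zy).
Qed.

Lemma spanning_subtree : connected_graph e -> exists E, subtree setT E.
Proof.
case=> V0 conn; have grow n : n < #|V| -> exists S E, subtree S E /\ #|S| = n.+1.
  elim: n => [_|n IH nV].
    case/card_gt0P: V0 => r _; exists [set r], set0.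
    by rewrite cards1; split=> //; apply: subtree1.
  have [S [E [SE cS]]] := IH (ltnW nV).
  have /set0Pn[x xS] : S != set0 by rewrite -card_gt0 cS.
  have /properP[_ [z _ zS]] : S \proper setT by rewrite properEcard subsetT cS cardsT.
  have [a [b [aS bS ab]]] := connect_exit (conn x z) xS zS.
  exists (b |: S), (E :|: edge a b).
  by rewrite cardsU1 bS cS; split=> //; apply: subtree_pendant.
have [|S [E [SE cS]]] := grow #|V|.-1; first by rewrite prednK.
have ST : S = setT by apply/eqP; rewrite eqEcard subsetT cardsT cS prednK /=.
by exists E; rewrite -ST.
Qed.

(** * Levels and degrees of internal vertices *)

(* These are the functions below the distance from r; requiring only the
   Lipschitz bound makes maximality yield the distance itself. *)
Definition levels E (r : V) (h : V -> nat) : Prop :=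
  h r = 0 /\ forall x y, adj E x y -> h y <= (h x).+1.

(** Levels rise by at most one per step of a simple path from the root. The bound lets them be
    stored in a finite type, so that a maximum exists. *)
Lemma levels_lt_card S E r h x : connects S E -> r \in S -> x \in S ->
  levels E r h -> h x < #|V|.
Proof.
move=> /connectsP[_ _ _ E_conn] rS xS [h0 hE].
have /connectP[p0 p0p ->] := E_conn _ _ rS xS.
case/shortenP: p0p => p pp up _.
have : size (r :: p) <= #|V| by rewrite -(card_uniqP up) max_card.
apply: leq_trans => /=; rewrite ltnS -[size p]addn0 -h0.
elim: p r {up rS h0 p0} pp => [|y p IH] r //= /andP[/hE hy /IH{}IH].
by apply: leq_trans IH _; rewrite addSn -addnS leq_add2l.
Qed.

Lemma max_levels S r E0 (P : pred {set V * V}) : r \in S ->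
  (forall E, P E -> connects S E) -> P E0 ->
  exists E h, [/\ P E, levels E r h
    & forall E' h', P E' -> levels E' r h' ->
        \sum_(x in S) h' x <= \sum_(x in S) h x].
Proof.
move=> rS PS P0.
pose Q (u : {set V * V} * {ffun V -> 'I_#|V|.+1}) :=
  [&& P u.1, u.2 r == 0 :> nat
    & [forall x, forall y, adj u.1 x y ==> (u.2 y <= (u.2 x).+1)]].
pose F (u : {set V * V} * {ffun V -> 'I_#|V|.+1}) := \sum_(x in S) (u.2 x : nat).
have Q0 : Q (E0, [ffun=> ord0]).
  rewrite /Q P0 ffunE /=; apply/forallP=> x; apply/forallP=> y.
  by rewrite !ffunE implybT.
case: (@arg_maxnP _ (E0, [ffun=> ord0]) Q F Q0) => [[E h]].
case/and3P=> /= PE /eqP h0 /forallP hE max.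
exists E, (fun x => h x : nat); split=> //.
  by split=> // x y xy; move/forallP: (hE x) => /(_ y) /implyP; apply.
move=> E' h' PE' [h'0 h'E]; have [sym' _ ES' _] := connectsP _ _ (PS _ PE').
(* Outside [S] the levels are unbounded and not summed, so they are set to 0. *)
pose g := [ffun x => inord (if x \in S then h' x else 0) : 'I_#|V|.+1].
have gE x : x \in S -> g x = h' x :> nat.
  move=> xS; rewrite ffunE xS inordK // ltnS ltnW //.
  exact: (levels_lt_card (PS _ PE') rS xS).
have Qg : Q (E', g).
  rewrite /Q PE' /= gE // h'0 eqxx /=; apply/forallP=> x; apply/forallP=> y.
  apply/implyP=> xy; rewrite !gE ?h'E //; first exact: ES' xy.
  exact: ES' (sym' _ _ xy).
have := max _ Qg; rewrite /F /= (eq_bigr h') // => x; exact: gE.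
Qed.

(** Edges into [a] keep the bound because no neighbour is lower, and edges out of [a] only gain
    slack. At a maximum no such raise is possible, so every vertex of [S] but the root has a lower
    neighbour. *)
Lemma levels_raise S E r h a : connects S E -> levels E r h -> a != r ->
  (forall y, adj E a y -> h a <= h y) ->
  levels E r (fun x => (x == a) + h x).
Proof.
move=> SE [h0 hE] ar ha; have [E_sym _ _ _] := connectsP _ _ SE.
split=> [|x y xy]; first by rewrite eq_sym (negPf ar).
have [ya|ya] := eqVneq y a.
  rewrite ya in xy *; rewrite (negPf (adj_neq SE xy)).
  by rewrite add1n add0n ltnS ha // E_sym.
rewrite add0n; apply: leq_trans (hE _ _ xy) _.
by rewrite ltnS leq_addl.
Qed.

Lemma sum_raise S (h : V -> nat) a : a \in S ->
  \sum_(x in S) ((x == a) + h x) = (\sum_(x in S) h x).+1.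
Proof.
move=> aS; rewrite big_split /= -add1n; congr (_ + _).
rewrite (bigD1 a) //= eqxx big1 // => x /andP[_ /negPf->] //.
Qed.

(** Choosing a lower neighbour for each vertex of [S] but the root gives |S| - 1 edges, which are
    all edges of the tree. So an edge at [a] that does not ascend is the one chosen for [a]. *)
Lemma unique_parent S E r h : subtree S E -> r \in S -> levels E r h ->
  (forall a, a \in S -> a != r -> exists2 y, adj E a y & h y < h a) ->
  forall a y z, adj E a y -> adj E a z -> h y <= h a -> h z <= h a -> y = z.
Proof.
move=> SE rS [h0 hE] par_ex; have SE1 := subtree_connects SE.
have [E_sym Ee ES E_conn] := connectsP _ _ SE1.
pose par a := odflt a [pick y | adj E a y && (h y < h a)].
have parP a : a \in S :\ r -> adj E a (par a) && (h (par a) < h a).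
  rewrite in_setD1 => /andP[ar aS]; rewrite /par.
  case: pickP => [y //|none]; have [y ay hy] := par_ex _ aS ar.
  by have := none y; rewrite ay hy.
pose F1 := [set (x, par x) | x in S :\ r].
pose F2 := [set (par x, x) | x in S :\ r].
have c1 : #|F1| = #|S :\ r| by rewrite card_imset // => x y [].
have c2 : #|F2| = #|S :\ r| by rewrite card_imset // => x y [].
have F12 : F1 :&: F2 = set0.
  apply/setP=> u; rewrite !inE; apply/negP=> /andP[].
  case/imsetP=> x /parP/andP[_ hx] -> /imsetP[y /parP/andP[_ hy] [xy yx]].
  by move: hx hy; rewrite yx -xy => hx /(ltn_trans hx); rewrite ltnn.
have FE : E = F1 :|: F2.
  apply/esym/eqP; rewrite eqEcard cardsU F12 cards0 c1 c2.
  apply/andP; split; last first.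
    have := subtree_card SE; have := cardsD1 r S; rewrite rS.
    by move: #|E| #|S| #|_ :\ _| => p q s; clear; lia.
  apply/subsetP=> u; rewrite inE => /orP[]/imsetP[x /parP/andP[xp _] ->].
    exact: xp.
  exact: E_sym xp.
have isp a y : adj E a y -> h y <= h a -> y = par a.
  rewrite /adj FE inE => /orP[]/imsetP[x xS [-> ->]] // hx.
  by have /andP[_] := parP _ xS; rewrite ltnNge hx.
by move=> a y z ay az hy hz; rewrite (isp _ _ ay hy) (isp _ _ az hz).
Qed.

(* Rotating edges away from the root of a tree increases the sum of the levels,
   so a maximal tree has no adjacent siblings. *)
Lemma internal_bound S E r t : 2 < t ->
  (forall v (N : {set V}), (forall y, y \in N -> e v y) -> t <= #|N| ->
     exists a b, [/\ a \in N, b \in N, a != b & e a b]) ->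
  subtree S E ->
  (forall E', subtree S E' -> #|leaves (adj E)| <= #|leaves (adj E')|) ->
  r \in S -> r \notin leaves (adj E) ->
  exists b, #|S| = #|leaves (adj E)| + b
    /\ (b = 1 /\ #|leaves (adj E)| < t \/ #|leaves (adj E)| + 2 * b <= t * b).
Proof.
move=> t3 free SE0 min rS rl0.
set k := #|leaves (adj E)| in min *.
pose P E' := [&& subtree S E', #|leaves (adj E')| == k & r \notin leaves (adj E')].
have [||E1 [h [/and3P[SE /eqP kE rl] lev max]]] := @max_levels S r E P rS.
- by move=> E' /andP[/subtree_connects].
- by rewrite /P SE0 eqxx.
have SE1 := subtree_connects SE.
have [E_sym Ee ES E_conn] := connectsP _ _ SE1; have [h0 hE] := lev.
have par_ex a : a \in S -> a != r -> exists2 y, adj E1 a y & h y < h a.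
  move=> aS ar.
  have [/existsP[y /andP[]]|] := boolP [exists y, adj E1 a y && (h y < h a)].
    by exists y.
  rewrite negb_exists => /forallP none.
  have := max E1 (fun x => (x == a) + h x).
  rewrite /P SE kE eqxx rl sum_raise // ltnn => H; suff: false by [].
  apply: H => //.
  by apply: levels_raise SE1 lev ar _ => y ay; have := none y; rewrite ay -leqNgt.
have uniq_par := unique_parent SE rS lev par_ex.
have h_gt0 a : a \in S -> a != r -> 0 < h a.
  by move=> aS /(par_ex _ aS)[y _]; case: (h a).
(* After [v a] is replaced by [a b], the vertex [a] has no lower neighbour, since [b] is level with
   it. Raising [a] then beats the maximum. *)
have no_siblings v a b : 2 < deg (adj E1) v -> adj E1 v a -> adj E1 v b ->
    a != b -> h v < h a -> h v < h b -> ~~ e a b.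
  move=> v3 va vb ab ha hb; apply/negP=> eab.
  have [SE' sub] := subtree_rotate SE va vb ab eab v3.
  have aS : a \in S by apply: ES (E_sym _ _ va).
  have hab : h a = h b.
    move: (hE _ _ va) (hE _ _ vb) ha hb; move: (h a) (h b) (h v) => p q s.
    by clear; lia.
  have lev' : levels (exchange E1 b a v a) r h.
    split=> // x y; rewrite adj_exchange (adj_edge b a) => /andP[+ _].
    case/orP=> [/hE //|]; move => /orP[]/andP[/eqP-> /eqP->]; rewrite hab //.
  have := max (exchange E1 b a v a) (fun x => (x == a) + h x).
  rewrite sum_raise // ltnn => H; suff: false by [].
  apply: H.
    rewrite /P SE' eqn_leq min // andbT -kE.
    rewrite (leq_trans (subset_leq_card sub)) ?subset_leq_card ?subD1set //=.
    by apply: contra rl => /(subsetP sub); rewrite in_setD1 => /andP[].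
  apply: levels_raise (subtree_connects SE') lev' _ _.
    by apply: contraTneq ha => ->; rewrite h0.
  move=> y; rewrite adj_exchange => /andP[+ yv]; case/orP=> [ay|].
    rewrite leqNgt; apply: contra yv => hy.
    rewrite (uniq_par _ _ _ ay (E_sym _ _ va) (ltnW hy) (ltnW ha)).
    by rewrite adj_edge !eqxx orbT.
  by rewrite adj_edge => /orP[]/andP[_ /eqP->]; rewrite ?hab.
pose I := S :\: leaves (adj E1).
have lS : leaves (adj E1) \subset S by apply/subsetP=> x; apply: leaf_in SE1.
have rI : r \in I by rewrite in_setD rl.
exists #|I|; split.
  by rewrite cardsD (setIidPr lS) -kE subnKC // subset_leq_card.
(* The degree sum is 2|S| - 2, to which each leaf contributes 1. *)
have sumI : k + \sum_(x in I) deg (adj E1) x + 2 = 2 * (k + #|I|).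
  have := subtree_card SE; rewrite -(sum_deg SE1) (big_setID (leaves (adj E1))) /=.
  rewrite (setIidPr lS) (eq_bigr (fun=> 1)) => [|x]; last by rewrite inE => /eqP.
  rewrite sum1_card kE -/I (cardsD S (leaves (adj E1))) (setIidPr lS) kE.
  have := subset_leq_card lS; rewrite kE.
  by move: (\sum_(x in I) _) #|S| => p q; clear; lia.
(* All neighbours of the root are higher, so [t] of them would include two adjacent siblings. *)
have deg_r : deg (adj E1) r < t.
  rewrite ltnNge; apply/negP=> dr.
  have [||a [b []]] := free r [set y | adj E1 r y].
  - by move=> y; rewrite inE => /Ee.
  - exact: dr.
  rewrite !inE => ra rb ab; apply/negP.
  apply: (no_siblings r) => //; first exact: leq_trans dr.
    by rewrite h0 h_gt0 ?(ES _ _ (E_sym _ _ ra)) // eq_sym (adj_neq SE1 ra).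
  by rewrite h0 h_gt0 ?(ES _ _ (E_sym _ _ rb)) // eq_sym (adj_neq SE1 rb).
(* At most one neighbour, the parent, is not higher than [v]; a degree above [t] would leave [t]
   siblings. *)
have deg_le v : v \in S -> deg (adj E1) v <= t.
  move=> vS; rewrite leqNgt; apply/negP=> dv.
  pose N := [set y | adj E1 v y & h v < h y].
  have cN : t <= #|N|.
    suff : #|[set y | adj E1 v y] :\: N| <= 1.
      have sub : N \subset [set y | adj E1 v y].
        by apply/subsetP=> y; rewrite !inE => /andP[].
      rewrite cardsD (setIidPr sub) -/(deg _ _).
      by move: dv; move: (deg _ _) #|N| => p q; clear; lia.
    rewrite leqNgt; apply/negP=> /card_gt1P[y [z [yN zN /eqP]]]; apply.
    move: yN zN; rewrite !inE => /andP[+ vy] /andP[+ vz].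
    rewrite vy vz /= -!leqNgt; exact: uniq_par.
  have [||a [b []]] := free v N => //.
    by move=> y; rewrite inE => /andP[/Ee].
  rewrite !inE => /andP[va ha] /andP[vb hb] ab; apply/negP.
  by apply: (no_siblings v) => //; apply: ltnW; apply: leq_trans dv; rewrite ltnS.
have [I1|I2] := leqP #|I| 1.
  left; have Ir : I = [set r].
    by apply/esym/eqP; rewrite eqEcard sub1set rI cards1.
  move: sumI deg_r; rewrite Ir cards1 big_set1; move: (k) (deg _ _) => p d.
  by clear; split=> //; lia.
(* [u] is an internal vertex of maximal level, so its higher neighbours are leaves. *)
right; case: (@arg_maxnP _ r (mem I) h rI) => u /= uI umax.
have uS : u \in S by move: uI; rewrite in_setD => /andP[].
have ur : u != r.
  have : 0 < #|I :\ r| by move: I2; rewrite (cardsD1 r I) rI add1n ltnS.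
  case/card_gt0P=> w; rewrite in_setD1 => /andP[wr wI].
  have wS : w \in S by move: wI; rewrite in_setD => /andP[].
  apply: contraTneq (umax _ wI) => ->.
  by rewrite /= h0 -ltnNge h_gt0.
have deg_u : deg (adj E1) u < t.
  rewrite ltnNge; apply/negP=> du.
  have [||a [b []]] := free u [set y | adj E1 u y].
  - by move=> y; rewrite inE => /Ee.
  - exact: du.
  rewrite !inE => ua ub ab eab.
  (* If [c] were higher than [u], it would be a leaf, and replacing [u d] by [c d] would make it
     internal and save a leaf. *)
  have noleaf c d : adj E1 u c -> adj E1 u d -> c != d -> e c d -> h c <= h u.
    move=> uc ud cd ecd; rewrite leqNgt; apply/negP=> hc.
    have cS : c \in S by apply: ES (E_sym _ _ uc).
    have cl : c \in leaves (adj E1).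
      apply: contraTT hc => cl; rewrite -leqNgt; apply: umax.
      by rewrite /I inE cl.
    have [||SE' sub] := subtree_rotate SE ud uc _ _ (leq_trans t3 du).
    - by rewrite eq_sym.
    - by rewrite e_sym.
    have := leq_trans (min _ SE') (subset_leq_card sub).
    by rewrite -kE (cardsD1 c (leaves (adj E1))) cl add1n ltnn.
  have ha := noleaf _ _ ua ub ab eab.
  have hb : h b <= h u by apply: (noleaf b a) => //; rewrite 1?eq_sym 1?e_sym.
  by rewrite (uniq_par _ _ _ ua ub ha hb) eqxx in ab.
have uI' : u \in I :\ r by rewrite in_setD1 ur.
(* The degrees of [r] and [u] are at most [t - 1] and the others at most [t], so those over [I] sum
   to at most [t * #|I| - 2]. *)
move: sumI; rewrite (big_setD1 r) //= (big_setD1 u) //=.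
have : \sum_(x in I :\ r :\ u) deg (adj E1) x <= t * #|I :\ r :\ u|.
  rewrite mulnC -sum_nat_const; apply: leq_sum => x; rewrite !inE.
  by case/and4P=> _ _ _ xS; apply: deg_le.
have := cardsD1 r I; have := cardsD1 u (I :\ r); rewrite rI uI'.
move=> c1 c2; rewrite c2 c1 /=.
move: (\sum_(x in _) _) #|_ :\ u| (deg _ _) (deg _ _) (k) deg_r deg_u => p q x y n.
by clear; nia.
Qed.

(** * From dominating subtrees to the theorem *)

(** The rest of a cycle would bypass any one of its edges, against [bridge]. *)
Lemma spanning_tree_subtree E : connected_graph e -> subtree setT E ->
  spanning_tree e (adj E).
Proof.
move=> [V0 _] SE; have SE1 := subtree_connects SE.
have [E_sym Ee ES E_conn] := connectsP _ _ SE1.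
split; first by move=> x y; apply: Ee.
split.
- split=> [x y|x]; first by apply/idP/idP; apply: E_sym.
  by apply/negbTE/negP=> /Ee; rewrite e_irr.
- by split=> // x y; apply: E_conn; rewrite inE.
case=> [|x [|y [|z q]]] // _ /andP[cyc U].
move: cyc; rewrite [cycle _ _]/= rcons_path => /and4P[xy yz zq lx].
apply: (negP (bridge SE xy)).
have c_sym : connect_sym (adj (E :\: edge x y)).
  apply: sym_connect_sym => a b; rewrite !adjD !adj_edge.
  rewrite (_ : adj E a b = adj E b a); last by apply/idP/idP; apply: E_sym.
  by rewrite orbC [(b == x) && _]andbC [(b == y) && _]andbC.
move: U; rewrite cons_uniq => /andP[xq U].
rewrite c_sym; apply: (@connect_trans _ _ (last z q)).
  apply/connectP; exists (z :: q) => //.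
  apply: (@sub_in_path _ (predC1 x) (adj E)); last by rewrite /= yz.
    move=> a b; rewrite !inE => ax bx ab.
    by rewrite adjD adj_edge ab (negPf ax) (negPf bx) andbF.
  by apply/allP=> u uq; apply: contraNneq xq => <-.
apply: connect1; rewrite adjD adj_edge lx /= negb_or !negb_and.
have lz : last z q \in z :: q by apply: mem_last.
have -> : last z q != x.
  by apply: contraNneq xq => <-; rewrite in_cons lz orbT.
have ly : last z q != y.
  by move: U; rewrite cons_uniq => /andP[+ _]; apply: contraNneq => <-.
by rewrite /= ly.
Qed.

(** Every vertex outside [S] is attached to one neighbour in [S]. A private neighbour can only be
    attached to its own leaf, so each leaf of [E] survives in the stem. *)
Lemma spanning_tree_stem S E : connected_graph e -> subtree S E ->
  dominating S ->
  (forall x, x \in leaves (adj E) -> exists y,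
     [/\ y \notin S, e x y & forall z, z \in S -> e z y -> z = x]) ->
  exists f : rel V, spanning_tree e f /\ #|leaves (stem f)| <= #|leaves (adj E)|.
Proof.
move=> conn SE /forallP Sd priv; have SE1 := subtree_connects SE.
have [E_sym Ee ES E_conn] := connectsP _ _ SE1.
pose dom y := odflt y [pick x | (x \in S) && e x y].
have domP y : y \notin S -> (dom y \in S) && e (dom y) y.
  move=> yS; rewrite /dom; case: pickP => [x //|none].
  have := Sd y; rewrite (negPf yS) /= => /existsP[x /andP[xS xy]].
  by have := none x; rewrite xS xy.
pose F := [set u | [|| adj E u.1 u.2, (u.1 \notin S) && (u.2 == dom u.1)
                     | (u.2 \notin S) && (u.1 == dom u.2)]].
have adjF a b : adj F a b = [|| adj E a b, (a \notin S) && (b == dom a)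
                     | (b \notin S) && (a == dom b)] by rewrite /adj inE.
have F_sym a b : adj F a b -> adj F b a.
  by rewrite !adjF => /or3P[/E_sym->|->|->]; rewrite ?orbT.
have SF : subtree setT F.
  apply/andP; split.
    apply/connectsP; split=> //.
    - move=> a b; rewrite adjF => /or3P[/Ee //||] /andP[/domP/andP[_ +] /eqP->] //.
      by rewrite e_sym.
    have c_sym : connect_sym (adj F).
      by apply: sym_connect_sym => a b; apply/idP/idP; apply: F_sym.
    pose pr a := if a \in S then a else dom a.
    have prS a : pr a \in S by rewrite /pr; case: ifPn => // /domP/andP[].
    have topr a : connect (adj F) a (pr a).
      rewrite /pr; case: ifPn => // aS.
      by apply: connect1; rewrite adjF aS eqxx orbT.
    move=> a b _ _; apply: connect_trans (topr a) _.
    rewrite c_sym; apply: connect_trans (topr b) _.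
    apply: connect_sub (E_conn _ _ (prS b) (prS a)) => p q pq.
    by apply: connect1; rewrite adjF pq.
  have sub : F \subset E :|: ([set (y, dom y) | y in ~: S]
                             :|: [set (dom y, y) | y in ~: S]).
    apply/subsetP=> [[a b]]; rewrite !inE /= => /or3P[|/andP[aS /eqP->]|/andP[bS /eqP->]].
    - by rewrite /adj => ->.
    - by rewrite imset_f ?orbT // inE.
    - by rewrite [X in _ || X]orbC imset_f ?orbT // inE.
  have cF : #|F| <= #|E| + (#|~: S| + #|~: S|).
    apply: leq_trans (subset_leq_card sub) _.
    apply: leq_trans (leq_card_setU _ _).1 _; rewrite leq_add2l.
    apply: leq_trans (leq_card_setU _ _).1 _.
    by rewrite leq_add ?leq_imset_card.
  have := subtree_card SE; have := cardsC S; rewrite cardsT; move: cF.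
  by move: #|F| #|E| #|~: S| #|S| => p q r s; clear; lia.
exists (adj F); split; first exact: spanning_tree_subtree.
have out_leaf y : y \notin S -> y \in leaves (adj F).
  move=> yS; rewrite inE; apply/cards1P; exists (dom y); apply/setP=> z.
  rewrite !inE adjF yS /=; have [//|zd] := eqVneq z (dom y); rewrite ?orbT //=.
  apply/negbTE; rewrite negb_or negb_and negbK; apply/andP; split.
    by apply: contra yS; apply: ES.
  have [//|zS /=] := boolP (z \in S); apply: contraNneq yS => ->.
  by have /andP[] := domP _ zS.
have leafN x : x \in leaves (adj E) -> x \notin leaves (adj F).
  move=> xl; have [y [yS xy uniq_y]] := priv _ xl; have [w xw _] := leafP xl.
  have : 1 < deg (adj F) x.
    apply: (@deg_ge2 _ _ w y); rewrite ?adjF ?xw //.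
      have /andP[dS dy] := domP _ yS.
      by rewrite yS (uniq_y _ dS dy) eqxx !orbT.
    by apply: contraNneq yS => <-; apply: ES (E_sym _ _ xw).
  by rewrite inE neq_ltn orbC => ->.
rewrite -(card_imset _ val_inj); apply: subset_leq_card.
apply/subsetP=> _ /imsetP[v vl ->]; have [vN vlE] := (valP v, vl).
have vS : val v \in S by apply: contraNT vN => /out_leaf.
move: vlE; rewrite !inE => /cards1P[w Nw].
have : w \in [set y | stem (adj F) v y] by rewrite Nw set11.
have inS (z : {x : V | x \notin leaves (adj F)}) : val z \in S.
  by have := valP z; apply: contraNT => /out_leaf.
have stemE (z : {x : V | x \notin leaves (adj F)}) :
    adj F (val v) (val z) = adj E (val v) (val z).
  by rewrite adjF vS (inS z) /= orbF.
rewrite inE /stem stemE => vw; apply/cards1P; exists (val w); apply/setP=> z.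
rewrite !inE; apply/idP/eqP=> [vz|-> //].
(* Tree neighbours of [v] lie in the stem: leaves of [E] by their private neighbours, others by
   having degree at least two. So [v] has degree one already in [E]. *)
have zF : z \notin leaves (adj F).
  have [/leafN //|] := boolP (z \in leaves (adj E)).
  rewrite !inE => dz; apply/negP=> /eqP dF.
  have zS : z \in S by apply: ES (E_sym _ _ vz).
  have S2 : 1 < #|S|.
    by apply/card_gt1P; exists (val v), z; split=> //; apply: adj_neq SE1 vz.
  have := deg_gt0 SE1 S2 zS; have := @deg_sub E F z set0.
  rewrite cards0 dF => H; have {}H : deg (adj E) z <= 1.
    by apply: H => y zy _; rewrite adjF zy.
  by move: dz H; case: (deg _ _) => [|[|]].
have : Sub z zF \in [set y | stem (adj F) v y] by rewrite inE /stem stemE.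
by rewrite Nw inE => /eqP <-.
Qed.

(** Otherwise [t] independent neighbours would induce a star centred at [v]. *)
Lemma star_free_edge t v (N : {set V}) : ~ has_induced (star t) e ->
  (forall y, y \in N -> e v y) -> t <= #|N| ->
  exists a b, [/\ a \in N, b \in N, a != b & e a b].
Proof.
move=> free vN /card_geqP[s [us ss sN]].
have [/existsP[a /existsP[b /and4P[]]]|] :=
  boolP [exists a, exists b, [&& a \in N, b \in N, a != b & e a b]].
  by exists a, b.
rewrite negb_exists => /forallP indep; case: free.
pose phi (o : option 'I_t) := if o is Some i then nth v s i else v.
have phiN i : phi (Some i) \in N by rewrite sN // mem_nth // ss.
have vphi i : e v (phi (Some i)) by apply: vN.
have phiv i : v != phi (Some i) by apply: contraTneq (vphi i) => <-; rewrite e_irr.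
exists phi; split.
  case=> [i|] [j|] // /eqP.
  - by rewrite nth_uniq ?ss // => /eqP/val_inj->.
  - by rewrite eq_sym (negPf (phiv i)).
  - by rewrite (negPf (phiv j)).
case=> [i|] [j|].
- have [->|ij] := eqVneq i j; first by rewrite e_irr.
  apply/negbTE; have := indep (phi (Some i)).
  rewrite negb_exists => /forallP/(_ (phi (Some j))).
  by rewrite !phiN /= nth_uniq ?ss // ij.
- by rewrite e_sym vphi.
- by rewrite vphi.
- by rewrite e_irr.
Qed.

Lemma dist_ge m x y :
  (forall p, path e x p -> last x p = y -> m <= size p) ->
  ((m%:Z)%:E <= dist e x y)%E.
Proof.
move=> H; apply/Order.TotalTheory.bigmin_geP; split; first exact: leey.
move=> k /existsP[p /andP[pp /eqP pl]]; rewrite lee_fin lez_nat.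
by have := H _ pp pl; rewrite size_tuple.
Qed.

(* The private neighbours are far apart, so their neighbourhoods are disjoint;
   these meet S only in L and avoid the private neighbours themselves. *)
Lemma sum_deg_private S E k (priv : V -> V) (L : {set V}) :
  (forall S' E', subtree S' E' -> dominating S' ->
     #|leaves (adj E)| <= #|leaves (adj E')|) ->
  2 < #|leaves (adj E)| -> subtree S E -> dominating S ->
  L \subset leaves (adj E) -> #|L| = k ->
  (forall x, x \in leaves (adj E) -> [/\ priv x \notin S, e x (priv x)
     & forall z, z \in S -> e z (priv x) -> z = x]) ->
  [/\ #|priv @: L| = k, spread e 4 (priv @: L)
    & \sum_(y in priv @: L) deg e y + #|S| <= #|V|].
Proof.
move=> min k3 SE Sd /subsetP sL cL privP; have SE1 := subtree_connects SE.
have priv_inj : {in L &, injective priv}.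
  move=> x z xL zL xz; have [_ xp _] := privP _ (sL _ xL).
  have [_ _ H] := privP _ (sL _ zL); apply: H; last by rewrite -xz.
  exact: leaf_in SE1 (sL _ xL).
(* A walk of at most three edges, prolonged to [x] and [z], would join two leaves. Each of its at
   most two inner vertices is adjacent to one of the private neighbours, so in [S] it can only be
   [x] or [z], against [no_leaf_path]. *)
have far x z p : x \in L -> z \in L -> x != z -> path e (priv x) p ->
    last (priv x) p = priv z -> 4 <= size p.
  move=> xL zL xz pp pl; rewrite leqNgt; apply/negP=> p4.
  have [xl zl] := (sL _ xL, sL _ zL).
  have [xpS xxp Hx] := privP _ xl; have [zpS zzp Hz] := privP _ zl.
  have inner : {in priv x :: rcons p z, forall u, u \in S -> u \in leaves (adj E)}.
    have near u : e (priv x) u -> u \in S -> u \in leaves (adj E).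
      by move=> xu uS; rewrite (Hx u uS) // e_sym.
    have near' u : e u (priv z) -> u \in S -> u \in leaves (adj E).
      by move=> uz uS; rewrite (Hz u uS).
    move=> u; rewrite in_cons mem_rcons in_cons => /or3P[/eqP->|/eqP-> //|].
      by rewrite (negPf xpS).
    case: p pp pl p4 => [|a [|b [|c [|d p]]]] //=; rewrite !in_cons ?in_nil ?orbF.
    - by move=> _ -> _ /eqP->; rewrite (negPf zpS).
    - move=> /and3P[xa _ _] -> _ /orP[]/eqP->; first exact: near.
      by rewrite (negPf zpS).
    - move=> /and4P[xa _ bc _] cz _; rewrite cz in bc *.
      case/or3P=> /eqP->; first exact: near.
        exact: near'.
      by rewrite (negPf zpS).
  have wp : path e x (priv x :: rcons p z) by rewrite /= xxp rcons_path pp pl e_sym zzp.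
  have wl : last x (priv x :: rcons p z) = z by rewrite /= last_rcons.
  case/shortenP: wp wl => q qp uq sq ql.
  apply: (@no_leaf_path S E x q) => //; first by rewrite ql.
    by apply: contraNneq xz => q0; rewrite -ql q0.
  by move=> u /sq; apply: inner.
have YS y : y \in priv @: L -> y \notin S.
  by case/imsetP=> x /sL/privP[? _ _] ->.
split; first by rewrite card_in_imset.
  apply/forall_inP=> _ /imsetP[x xL ->]; apply/forall_inP=> _ /imsetP[z zL ->].
  apply/implyP=> xz; apply: dist_ge => p; apply: far => //.
  by apply: contraNneq xz => ->.
(* Double counting: each vertex has at most one neighbour among the chosen private ones, and none
   unless it lies in [W], which has at most |V| - |S| elements. *)
pose W := L :|: (~: S :\: priv @: L).
have cW : #|W| + #|S| <= #|V|.
  have sY : priv @: L \subset ~: S by apply/subsetP=> y /YS; rewrite inE.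
  have := (leq_card_setU L (~: S :\: priv @: L)).1; rewrite -/W.
  rewrite cardsD (setIidPr sY) card_in_imset //.
  have := subset_leq_card sY; rewrite card_in_imset //.
  have := cardsC S; move: #|~: S| #|S| #|L| #|W| #|V| => p q r s n; clear; lia.
apply: leq_trans cW; rewrite leq_add2r.
rewrite (eq_bigr (fun y => \sum_u (e y u : nat))) => [|y _]; last first.
  by rewrite /deg cardsE -sum1_card big_mkcond.
rewrite exchange_big /= -sum1_card [X in _ <= X]big_mkcond; apply: leq_sum => u _.
have cu : \sum_(y in priv @: L) (e y u : nat) = #|[set y in priv @: L | e y u]|.
  by rewrite -sum1dep_card big_mkcondr; apply: eq_bigr => y _; case: (e y u).
rewrite cu; case: ifPn => uW.
  rewrite leqNgt; apply/negP=> /card_gt1P[a [b []]]; rewrite !inE.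
  case/andP=> /imsetP[x xL ->] xu /andP[/imsetP[z zL ->] zu] xz.
  have := @far x z [:: u; priv z] xL zL; rewrite /= xu e_sym zu /=.
  by move=> H; suff: 4 <= 2 by []; apply: H => //; apply: contraNneq xz => ->.
rewrite leqn0 cards_eq0; apply: contraR uW => /set0Pn[y].
rewrite !inE => /andP[/imsetP[x xL ->] xu].
have [uS|uS] := boolP (u \in S).
  have [_ _ Hx] := privP _ (sL _ xL).
  by rewrite (Hx u uS) ?xL // e_sym.
rewrite andbT orbC; apply/orP; left; apply/negP=> /imsetP[z zL uz].
have := @far x z [:: u] xL zL; rewrite /= xu uz /= => H.
suff: 4 <= 1 by []; apply: H => //.
by apply: contraTneq xu => xz; rewrite uz xz e_irr.
Qed.

End Subtrees.

(** * The extremal dominating subtree and the final count *)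

Theorem theorem1p6 (V : finType) (e : rel V) (t l : nat)
    (t_ge3 : 3 <= t)
    (e_simple : simple_graph e)
    (e_connected : connected_graph e)
    (e_free : ~ has_induced (star t) e)
    (l_ge2 : 2 <= l)
    (l_neq : l <> t - 2)
    (sigma_ge :
      ((#|V|%:Z - ((l * (t - 1)) %/ (t - 2))%N%:Z - 1)%R%:E
         <= sigma e 4 (l + 1))%E) :
  exists f : rel V, spanning_tree e f /\ #|leaves (stem f)| <= l.
Proof.
have [e_sym e_irr] := e_simple.
pose P (u : {set V} * {set V * V}) := subtree e u.1 u.2 && dominating e u.1.
(* The factor exceeds every possible |S|, so the order is lexicographic: leaves first, then
   vertices. *)
pose weight (u : {set V} * {set V * V}) := #|leaves (adj u.2)| * #|V|.+1 + #|u.1|.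
have [E0 SE0] := spanning_subtree e_sym e_connected.
have P0 : P (setT, E0).
  by rewrite /P SE0; apply/forallP=> y; rewrite inE.
case: (@arg_minnP _ _ P weight P0) => [[S E]] /andP[/= SE Sd] wmin.
have SE1 := subtree_connects SE.
have min_leaves S' E' : subtree e S' E' -> dominating e S' ->
    #|leaves (adj E)| <= #|leaves (adj E')|.
  move=> SE' Sd'; have := wmin (S', E'); rewrite /P SE' Sd' /weight /= => /(_ isT).
  have := max_card (mem S'); move: #|leaves (adj E)| #|leaves (adj E')| #|S| #|S'| #|V|.
  by move=> p q r s n; clear; nia.
have min_card S' E' : subtree e S' E' -> dominating e S' ->
    #|leaves (adj E')| <= #|leaves (adj E)| -> #|S| <= #|S'|.
  move=> SE' Sd'; have := wmin (S', E'); rewrite /P SE' Sd' /weight /= => /(_ isT).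
  by move: #|leaves (adj E)| #|leaves (adj E')| => p q; clear; nia.
have priv_ex x := private_neighbour e_irr min_card SE Sd (x := x).
have [kl|lk] := leqP #|leaves (adj E)| l.
  have [f [ft fl]] := spanning_tree_stem e_sym e_irr e_connected SE Sd priv_ex.
  by exists f; split=> //; apply: leq_trans kl.
exfalso; have k3 : 2 < #|leaves (adj E)| by apply: leq_trans lk.
pose priv x := odflt x
  [pick y | [&& y \notin S, e x y & [forall z in S, e z y ==> (z == x)]]].
have privP x : x \in leaves (adj E) -> [/\ priv x \notin S, e x (priv x)
    & forall z, z \in S -> e z (priv x) -> z = x].
  move=> xl; rewrite /priv; case: pickP => [y /and3P[yS xy /forall_inP Hy]|none].
    by split=> // z zS zy; have := Hy z zS; rewrite zy => /eqP.
  have [y [yS xy Hy]] := priv_ex x xl; have := none y.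
  rewrite yS xy /= => /negbT/negP[]; apply/forall_inP=> z zS.
  by apply/implyP=> zy; apply/eqP/Hy.
have [s [us ss sl]] := card_geqP lk.
have sL : [set x in s] \subset leaves (adj E) by apply/subsetP=> x; rewrite inE => /sl.
have cL : #|[set x in s]| = l + 1 by rewrite cardsE (card_uniqP us) ss addn1.
have [cY Yspread Ysum] :=
  sum_deg_private e_sym e_irr min_leaves k3 SE Sd sL cL privP.
(* The degree sum of the private neighbours is at most |V| - |S|, which turns the bound on [sigma]
   into one on |S|. *)
have {sigma_ge} : #|S| <= (l * (t - 1)) %/ (t - 2) + 1.
  have PY : (#|priv @: [set x in s]| == l + 1) && spread e 4 (priv @: [set x in s]).
    by rewrite cY eqxx.
  have := Order.TotalTheory.bigmin_le_cond +oo%E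
    (P := fun A : {set V} => (#|A| == l + 1) && spread e 4 A)
    (fun A : {set V} => ((\sum_(a in A) deg e a)%N%:Z)%:E) PY.
  move/(Order.POrderTheory.le_trans sigma_ge).
  rewrite lee_fin; move: Ysum; move: (\sum_(y in _) _) (_ %/ _) #|V| #|S|.
  by move=> p q r n; clear; lia.
have lS : leaves (adj E) \subset S by apply/subsetP=> x; apply: leaf_in SE1.
(* If all vertices were leaves, then |S| = 2|S| - 2, so there would be only two. *)
have [r rS rl] : exists2 r, r \in S & r \notin leaves (adj E).
  apply/subsetPn; apply/negP=> Sl; have ES : S = leaves (adj E).
    by apply/eqP; rewrite eqEsubset Sl.
  have := subtree_card e_irr SE; rewrite -(sum_deg SE1) (eq_bigr (fun=> 1)).
    by rewrite sum1_card {1 2}ES; move: k3; move: #|leaves _| => k; clear; lia.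
  by move=> x /(subsetP Sl); rewrite inE => /eqP.
have [b [cS Hb]] := internal_bound e_sym e_irr t_ge3
  (fun v N => star_free_edge e_sym e_irr e_free) SE
  (fun E' SE' => min_leaves S E' SE' Sd) rS rl.
have := leq_divM (l * (t - 1)) (t - 2).
rewrite {}cS; move: Hb lk; move: #|leaves _| (_ %/ _) => k q.
move=> kb lk le_q le_S.
have [t' t'E] : exists t', t = t'.+2 by exists (t - 2); lia.
move: kb le_q l_neq; rewrite t'E -[t'.+2]addn2 addnK.
have -> : t' + 2 - 1 = t'.+1 by rewrite addnS subn1 /= addn1.
case=> [[b1 kt]|kb] le_q l_neq'.
  (* For [b = 1] the bounds give [l < k < t] and [t - 2 <= l], hence [l = t - 2]. *)
  have : l.+1 * t' <= l * t'.+1.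
    by apply: leq_trans le_q; rewrite leq_mul2r; apply/orP; right; lia.
  by rewrite mulSn mulnS; lia.
(* This amounts to [b * t' <= k - 1], whereas the degree count gives [k <= b * t']. *)
have : (k + b - 1) * t' <= (k - 1) * t'.+1.
  apply: leq_trans (leq_trans le_q _); first by rewrite leq_mul2r; apply/orP; right; lia.
  by rewrite leq_mul2r; apply/orP; right; lia.
nia.
Qed.
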